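(* Let $D$ be an eulerian digraph in which every vertex has degree congruent to $2$ mod $4$, and let $T$ be any directed euler circuit of $D$. Then $D$ has a bi-eulerian directed embedding (which is necessarily orientable) with one of its two faces bounded by $T$.
   Context: Digraphs are finite and may have loops and multiple arcs; the degree of a vertex is its total degree (indegree plus outdegree). A digraph is eulerian if it has a directed circuit using every arc and every vertex (a directed euler circuit). Embeddings are cellular embeddings in closed surfaces. A directed embedding is an embedding in which every face is bounded by a directed closed walk. A bi-eulerian embedding of a digraph is an embedding with exactly two faces, each bounded by a directed euler circuit. *)

(* Defs.v *)
From HB Require Import structures.
From mathcomp Require Import all_boot fingroup perm.
Set Implicit Arguments.
Unset Strict Implicit.
Unset Printing Implicit Defensive.

Record digraph := Digraph {
  dvertex : finType;
  darc : finType;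
  src : darc -> dvertex;
  tgt : darc -> dvertex
}.

Section Digraphs.

Variable D : digraph.

(* A loop counts twice. *)
Definition degree (v : dvertex D) : nat :=
  #|[set a : darc D | src a == v]| + #|[set a : darc D | tgt a == v]|.

(* Closed walks are given by their cyclic arc sequence, written from an
   arbitrary starting arc, and have at least one arc.  In particular the
   digraph with no vertices is not eulerian. *)
Definition directed_closed_walk (W : seq (darc D)) : Prop :=
  W <> [::] /\ path.cycle [rel a b | tgt a == src b] W.

Definition directed_circuit (W : seq (darc D)) : Prop :=
  directed_closed_walk W /\ uniq W.

Definition directed_euler_circuit (W : seq (darc D)) : Prop :=
  [/\ directed_circuit W,
      forall a : darc D, a \in W
    & forall v : dvertex D, exists2 a, a \in W & (src a == v) || (tgt a == v)].

Definition eulerian : Prop := exists W, directed_euler_circuit W.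

(* The two ends of an arc [a]: [(a, false)] at its tail, [(a, true)] at its
   head. *)
Definition arc_end : finType := (darc D * bool)%type.

Definition tail_end (a : darc D) : arc_end := (a, false).
Definition other_end (h : arc_end) : arc_end := (h.1, ~~ h.2).
Definition end_vertex (h : arc_end) : dvertex D :=
  if h.2 then tgt h.1 else src h.1.

(* Cellular embeddings of a connected digraph in closed surfaces, orientable
   or not, are encoded up to homeomorphism by rotation systems with edge
   signatures: a cyclic ordering of the arc ends at each vertex, with respect
   to a local orientation there, and, for each arc, whether the local
   orientations at its two ends disagree along it ([twisted]). *)
Record embedding := Embedding {
  rotation : {perm arc_end};
  twisted : darc D -> bool;
  rotation_vertex : forall h h' : arc_end,
    (h' \in porbit rotation h) = (end_vertex h' == end_vertex h)
}.

(* The flag [(h, o)] is the arc end [h] with one of its two sides: the side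
   towards [rotation h] if [o] is [true], the side towards [rotation^-1 h] if
   [o] is [false]. *)
Definition flag : finType := (arc_end * bool)%type.

Section Embeddings.

Variable M : embedding.

(* The other side of the same arc end. *)
Definition cross (f : flag) : flag := (f.1, ~~ f.2).

(* The other end of the same arc, on the same side of the arc.  The side that
   follows the arc in the rotation at one end precedes it at the other end
   when the local orientations agree. *)
Definition along (f : flag) : flag :=
  (other_end f.1, f.2 (+) ~~ twisted M f.1.1).

(* The other arc end at the same corner of the same face. *)
Definition corner (f : flag) : flag :=
  if f.2 then (rotation M f.1, false) else ((rotation M)^-1%g f.1, true).

Definition face_of (f : flag) : {set flag} :=
  [set g | connect [rel x y | (y == along x) || (y == corner x)] f g].

Definition faces : {set {set flag}} := [set face_of f | f : flag].

(* Face tracing: traverse an arc starting from the end [f.1], keeping to the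
   side given by [f.2], then turn at the corner reached. *)
Definition face_step (f : flag) : flag := corner (along f).

(* [W] is the boundary of [F], each arc being traversed from tail to head. *)
Definition bounded_by (F : {set flag}) (W : seq (darc D)) : Prop :=
  exists2 f, f \in F &
    [seq g.1 | g <- orbit face_step f] = [seq tail_end a | a <- W].

Definition directed_embedding : Prop :=
  forall F, F \in faces ->
    exists2 W, directed_closed_walk W & bounded_by F W.

Definition bi_eulerian : Prop :=
  #|faces| = 2 /\
  forall F, F \in faces ->
    exists2 W, directed_euler_circuit W & bounded_by F W.

(* A flag determines a local orientation of the surface, and adjacent flags
   determine opposite ones; a global orientation selects the flags that agree
   with it. *)
Definition orientable : Prop :=
  exists c : flag -> bool, forall f,
    [/\ c (cross f) = ~~ c f, c (along f) = ~~ c f & c (corner f) = ~~ c f].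

End Embeddings.
End Digraphs.

(* Main.v *)
(** Let [t] be the cyclic permutation of the arcs given by [T].  If the rotation
    at every vertex sends each incoming arc [a] to the outgoing arc [t (s a)]
    and each outgoing arc [b] to the incoming arc [t^-1 b], then the rotation is
    one cycle at each vertex exactly when the orbits of [s] are the sets of arcs
    with a common head; the two families of faces are traced by [t] and
    [t \o s], and the embedding is bi-eulerian as soon as [t \o s] is also one
    cycle.  Such an [s] is built one vertex at a time, using that indegrees are
    odd.  Conversely, in a directed embedding both kinds of face-adjacency of
    flags exchange heads and tails, and when a face is bounded by an euler
    circuit exactly one of the two sides of each arc end is in that face; hence
    the sum of head-or-tail and membership in one fixed face is a global
    orientation. *)

Require Import Defs.
From HB Require Import structures.
From mathcomp Require Import all_boot fingroup perm.
Set Implicit Arguments.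
Unset Strict Implicit.
Unset Printing Implicit Defensive.

(** * Splicing permutations into a single cycle along sets of odd size *)

Section FirstReturn.

Variables (A : finType) (t : {perm A}) (B : {set A}).
Hypothesis t_trans : forall x y, fconnect t x y.
Hypothesis B_odd : odd #|B|.

(** Outside [B] the maps [t \o s] and [t] agree, so [t \o s] follows the [t]-path from [t y] until
    it meets [B]. *)
Lemma first_return (s : A -> A) y l z :
  {in [predC B], forall x, s x = x} -> fpath t y (rcons l z) ->
  ~~ has (mem B) l -> fconnect (t \o s) (t y) z.
Proof.
move=> sB; elim: l y => [|w l IHl] y /=; first by case/andP=> /eqP-> _.
case/andP=> /eqP-> w_path; rewrite negb_or => /andP[wB /(IHl _ w_path)].
by apply: connect_trans; rewrite -[w in t w](sB w wB) fconnect1.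
Qed.

(* [s] sends each element of [B] to the next element of [B] on the cycle [t].
   On [B], the first-return map of [t \o s] is then the square of that of [t],
   which is still one cycle since the length is odd. *)
Lemma odd_splice : exists s : {perm A},
  [/\ {in [predC B], forall x, s x = x}, {in B &, forall x y, fconnect s x y}
    & forall x y, fconnect (t \o s) x y].
Proof.
have [b bB] : exists b, b \in B by apply/card_gt0P; case: #|B| B_odd.
pose S := filter (mem B) (orbit t b).
have uS : uniq S by rewrite filter_uniq ?orbit_uniq.
have mS x : (x \in S) = (x \in B).
  by rewrite mem_filter -fconnect_orbit t_trans andbT.
pose s := perm (can_inj (prev_next uS)).
have sE x : s x = next S x by rewrite permE.
have sB : {in [predC B], forall x, s x = x}.
  by move=> x; rewrite !inE sE -mS => xS; rewrite next_nth (negPf xS).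
have cS : fcycle s S by rewrite (eq_fcycle sE) cycle_next.
have s_in x : (s x \in B) = (x \in B) by rewrite sE -!mS mem_next.
have s_conn : {in B &, forall x y, fconnect s x y}.
  by move=> x y xB yB; rewrite (fconnect_cycle cS) ?mS.
exists s; split=> //.
have ret y : y \in B -> fconnect (t \o s) (t y) (s y).
  move=> yB; have y_orb : y \in orbit t b by rewrite -fconnect_orbit.
  have [i q def_q] := rot_to y_orb.
  have t_path : fpath t y (rcons q y).
    by have := cycle_orbit (@perm_inj _ t) b; rewrite -(rot_cycle i) def_q.
  (* The list [rcons q y] goes once around [t] from just after [y]; its closing [y] covers the case
     where [B] is a singleton. *)
  have def_sy : s y = head y (filter (mem B) (rcons q y)).
    have <- : next (filter (mem B) (y :: q)) y = s y.
      rewrite -def_q sE.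
      rewrite -(next_rot (size (filter (mem B) (take i (orbit t b)))) uS).
      by rewrite /S -{3}(cat_take_drop i (orbit t b)) !filter_cat rot_size_cat.
    rewrite filter_rcons /= yB /=.
    by case: (filter _ q) => [|z l] /=; rewrite eqxx.
  have hasB : has (mem B) (rcons q y) by rewrite has_rcons /= yB.
  rewrite def_sy; case: (split_find hasB) t_path => z l1 l2 zB l1B.
  rewrite cat_path => /andP[/(first_return sB)/(_ l1B) + _].
  rewrite filter_cat filter_rcons zB.
  by move: l1B; rewrite has_filter negbK => /eqP->.
have step2 y : y \in B -> fconnect (t \o s) y (s (s y)).
  move=> yB; apply: connect_trans (fconnect1 _ _) _.
  by apply: ret; rewrite s_in.
have steps k y : y \in B -> fconnect (t \o s) y (iter k.*2 s y).
  move=> yB; elim: k => // k IHk; apply: connect_trans IHk _.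
  rewrite doubleS /=; apply: step2.
  by elim: (k.*2) => //= m; rewrite s_in.
(* Since [s] has order [#|B|] at [y], [s y] equals the iterate of [s] at [y] of order [#|B|.+1],
   which is even, and [steps] applies. *)
have step1 y : y \in B -> fconnect (t \o s) y (s y).
  move=> yB; have yS : y \in S by rewrite mS.
  have {2}<- := iter_order (@perm_inj _ s) y.
  have -> : fingraph.order s y = #|B|.
    rewrite (order_cycle cS uS yS) -(card_uniqP uS).
    exact: eq_card.
  rewrite -iterS.
  have <- : (#|B|./2.+1).*2 = #|B|.+1.
    by rewrite doubleS -[in RHS](odd_double_half #|B|) B_odd.
  exact: steps.
have B_conn x : x \in B -> fconnect (t \o s) b x.
  move=> xB; have <- := iter_findex (s_conn b x bB xB).
  elim: (findex s b x) => //= n IHn; apply: connect_trans IHn (step1 _ _).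
  by elim: n => //= n; rewrite s_in.
have f_inj : injective (t \o s) by apply: inj_comp; apply: perm_inj.
have b_conn x : fconnect (t \o s) b x.
  have <- := iter_findex (t_trans b x).
  elim: (findex t b x) => //= n; move: (iter n t b) => z z_conn.
  have [zB | zB] := boolP (z \in B); last first.
    rewrite -[z in t z](sB z zB).
    exact: connect_trans z_conn (fconnect1 _ _).
  (* For [z] in [B], [t z] is the image under [t \o s] of the [s]-preimage of [z], which lies in [B]
     and is already reached. *)
  rewrite -[z](permKV s).
  apply: connect_trans (B_conn _ _) (fconnect1 (t \o s) _).
  by rewrite -s_in permKV.
by move=> x y; rewrite (connect_trans _ (b_conn y)) // fconnect_sym.
Qed.

End FirstReturn.

(** Fibres are spliced one at a time: [odd_splice], applied to the one-cycle map [t \o s] and the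
    next fibre, yields [r], and [s] is replaced by [s \o r], written [r * s]. *)
Lemma odd_fiber_splice (A V : finType) (k : A -> V) (t : {perm A}) :
    (forall x y, fconnect t x y) ->
    (forall v, odd #|[set x | k x == v]|) ->
  exists s : {perm A},
    (forall x y, fconnect s x y = (k x == k y)) /\
    (forall x y, fconnect (t \o s) x y).
Proof.
move=> t_trans k_odd.
suff /(_ (enum V) (enum_uniq _)) [s [s_k _ s_conn ts_conn]] :
    forall vs, uniq vs -> exists s : {perm A},
      [/\ forall x, k (s x) = k x, forall x, k x \notin vs -> s x = x,
          forall x y, k x \in vs -> k x = k y -> fconnect s x y
        & forall x y, fconnect (t \o s) x y].
  exists s; split=> // x y; apply/idP/eqP => [|kxy].
    by apply: fconnect_invariant => z /=; rewrite s_k eqxx.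
  by apply: s_conn; rewrite ?mem_enum.
elim=> [|v vs IHvs] /=.
  exists 1%g; split=> // [x|x|x y]; rewrite ?perm1 //.
  by rewrite (eq_fconnect (f' := t)) // => z /=; rewrite perm1.
case/andP=> v_vs /IHvs[s [s_k s_id s_conn ts_conn]].
have tsE : (s * t)%g =1 t \o s by move=> z; rewrite permM.
have := odd_splice (t := (s * t)%g) _ (k_odd v).
case=> [x y|r [r_id r_conn tsr_conn]].
  by rewrite (eq_fconnect tsE).
(* A point sent out of the fibre would land on a fixed point of [r], against injectivity. *)
have r_k x : k (r x) = k x.
  have [xv | xv] := eqVneq (k x) v; last by rewrite r_id // !inE.
  apply/eqP; rewrite xv; apply: contraT => rxv.
  suff /perm_inj eq_rx : r (r x) = r x by rewrite eq_rx xv eqxx in rxv.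
  by rewrite r_id // !inE.
exists (r * s)%g; split=> [x|x|x y|x y]; rewrite ?permM ?s_k //.
- by rewrite inE negb_or => /andP[xv xvs]; rewrite r_id ?s_id // !inE.
- rewrite inE => x_vs kxy.
  have iter_k (p : {perm A}) n : (forall z, k (p z) = k z) ->
      k (iter n p x) = k x.
    by move=> p_k; elim: n => //= n; rewrite p_k.
  (* On the fibre of [x], [r * s] coincides with [r] if the fibre is the new one and with [s]
     otherwise. *)
  suff [p p_conn [p_k p_eq]] : exists2 p : {perm A}, fconnect p x y &
      (forall z, k (p z) = k z) /\ forall z, k z = k x -> (r * s)%g z = p z.
    rewrite -(iter_findex p_conn); elim: (findex p x y) => //= n IHn.
    rewrite -p_eq; last exact: iter_k.
    exact: connect_trans IHn (fconnect1 _ _).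
  have [xv | xv] := eqVneq (k x) v.
    exists r; first by apply: r_conn; rewrite inE -?kxy xv.
    by split=> // z zx; rewrite permM s_id // r_k zx xv.
  move: x_vs; rewrite (negPf xv) /= => x_vs.
  exists s; first exact: s_conn.
  by split=> // z zx; rewrite permM r_id // !inE zx.
- rewrite (eq_fconnect (f' := (s * t)%g \o r)) // => z.
  by rewrite /= !permM.
Qed.

(** * Orientability of directed bi-eulerian embeddings *)

Lemma uniq_map_inj (T1 T2 : eqType) (f : T1 -> T2) (s : seq T1) :
  uniq (map f s) -> {in s &, injective f}.
Proof.
move=> us x y /(nthP x)[i lt_i <-] /(nthP x)[j lt_j <-].
rewrite -!(nth_map x (f x)) // => /eqP.
by rewrite (nth_uniq _ _ _ us) ?size_map // => /eqP->.
Qed.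

Section Orientable.

Variables (D : digraph) (M : embedding D).

Lemma along_involutive : involutive (along M).
Proof.
by case=> [[a i] o]; rewrite /along /other_end /= negbK; case: o; case: twisted.
Qed.

Lemma corner_involutive : involutive (corner M).
Proof. by case=> h [] /=; rewrite /corner /= ?permK ?permKV. Qed.

Lemma face_step_inj : injective (face_step M).
Proof.
exact: inj_comp (inv_inj corner_involutive) (inv_inj along_involutive).
Qed.

Lemma face_connect_sym :
  connect_sym [rel x y | (y == along M x) || (y == corner M x)].
Proof.
apply: sym_connect_sym => f g /=.
rewrite -(inv_eq along_involutive f g) -(inv_eq corner_involutive f g).
by rewrite ![g == _]eq_sym.
Qed.

Lemma face_of_refl f : f \in face_of M f.
Proof. by rewrite inE connect0. Qed.

Lemma along_in_face f g : (along M g \in face_of M f) = (g \in face_of M f).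
Proof.
rewrite !inE; apply/esym/(same_connect1r face_connect_sym) => /=.
by rewrite eqxx.
Qed.

Lemma corner_in_face f g : (corner M g \in face_of M f) = (g \in face_of M f).
Proof.
rewrite !inE; apply/esym/(same_connect1r face_connect_sym) => /=.
by rewrite eqxx orbT.
Qed.

Lemma face_of_eq f g : g \in face_of M f -> face_of M f = face_of M g.
Proof.
rewrite inE => fg; apply/setP=> h.
by rewrite !inE (same_connect face_connect_sym fg).
Qed.

Lemma face_of_in f : face_of M f \in faces M.
Proof. exact: imset_f. Qed.

Section DirectedTrace.

Variables (g : flag D) (W : seq (darc D)).
Hypothesis g_W :
  [seq h.1 | h <- orbit (face_step M) g] = [seq tail_end a | a <- W].

Lemma trace_tail h : h \in orbit (face_step M) g -> h.1.2 = false.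
Proof. by move=> /(map_f fst); rewrite g_W => /mapP[a _ ->]. Qed.

(** The face step into [h] ends with [corner]; undoing it leaves [along] of the preceding traced
    flag, which lies at a tail. *)
Lemma trace_corner h : h \in orbit (face_step M) g ->
  (corner M h).1.2 = true /\ along M (corner M h) \in orbit (face_step M) g.
Proof.
move=> hS; pose h' := finv (face_step M) h.
have hS' : h' \in orbit (face_step M) g.
  rewrite -fconnect_orbit (same_fconnect1_r face_step_inj).
  by rewrite (f_finv face_step_inj) fconnect_orbit.
have -> : corner M h = along M h'.
  by rewrite -[in LHS](f_finv face_step_inj h) /face_step corner_involutive.
by rewrite along_involutive /= (trace_tail hS').
Qed.

(* The trace of a directed face consists of its flags lying at tails. *)
Lemma trace_face h : h \in face_of M g ->
  (if h.1.2 then along M h else h) \in orbit (face_step M) g.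
Proof.
rewrite inE; set S := orbit _ g.
pose P := [pred h | (if h.1.2 then along M h else h) \in S].
have gS : g \in S by exact: in_orbit.
suff clP : closed [rel x y | (y == along M x) || (y == corner M x)] P.
  by move/(closed_connect clP); rewrite !inE (trace_tail gS) gS => <-.
apply: (intro_closed face_connect_sym) => x y /orP[] /eqP-> {y}; rewrite !inE.
  by rewrite [(along M x).1.2]/=; case: x.1.2; rewrite //= along_involutive.
case: x.1.2 => xS; last by have [-> ->] := trace_corner xS.
have cxS : corner M x \in S by rewrite -[x]along_involutive; apply: mem_orbit.
by rewrite trace_tail.
Qed.

Lemma trace_corner_end h : h \in face_of M g -> (corner M h).1.2 = ~~ h.1.2.
Proof.
move/trace_face; case: h.1.2 => hS; last by have [->] := trace_corner hS.
by apply: trace_tail; rewrite -[h]along_involutive; apply: mem_orbit.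
Qed.

End DirectedTrace.

(** At a tail, the two sides cannot both be in the face because [W] repeats no arc, and one of them
    is because [W] uses every arc. *)
Lemma directed_euler_face_cross g W f :
    directed_euler_circuit W ->
    [seq h.1 | h <- orbit (face_step M) g] = [seq tail_end a | a <- W] ->
  (cross f \in face_of M g) = (f \notin face_of M g).
Proof.
case=> [[_ uW] W_all _] g_W.
(* [along] commutes with [cross] and preserves the face, so flags at heads reduce to flags at
   tails. *)
wlog f_tail : f / f.1.2 = false => [wlog_f|].
  case f_end: f.1.2; last exact: wlog_f.
  rewrite -(along_in_face g (cross f)) -(along_in_face g f).
  have -> : along M (cross f) = cross (along M f).
    by rewrite /along /cross /= addNb.
  by apply: wlog_f; rewrite /= f_end.
have fst_inj : {in orbit (face_step M) g &, injective fst}.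
  apply: uniq_map_inj; rewrite g_W map_inj_uniq // => a b [//].
have inS h : h.1.2 = false -> h \in face_of M g -> h \in orbit (face_step M) g.
  by move=> h_tail /(trace_face g_W); rewrite h_tail.
apply/idP/idP => [cf_g|].
  apply/negP => f_g; have cfS := inS (cross f) f_tail cf_g.
  have /(congr1 snd) := fst_inj _ _ cfS (inS f f_tail f_g) erefl.
  by rewrite /=; case: f.2.
have /mapP[h hS def_h] : f.1 \in [seq h.1 | h <- orbit (face_step M) g].
  rewrite g_W; apply/mapP; exists f.1.1 => //.
  by case: f f_tail => [[a i] o] /= ->.
have h_g : h \in face_of M g.
  rewrite -fconnect_orbit in hS; rewrite -(iter_findex hS).
  elim: findex => [|n IHn] /=; first exact: face_of_refl.
  by rewrite /face_step corner_in_face along_in_face.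
move=> f_g; have [eq_o | neq_o] := eqVneq f.2 h.2.
  by rewrite [f]surjective_pairing def_h eq_o -surjective_pairing h_g in f_g.
suff -> : cross f = h by [].
rewrite /cross def_h [h in RHS]surjective_pairing.
by case: f.2 h.2 neq_o => [] [].
Qed.

Lemma directed_bi_eulerian_orientable :
  directed_embedding M -> bi_eulerian M -> orientable M.
Proof.
move=> M_dir [_ M_euler].
have corner_end f : (corner M f).1.2 = ~~ f.1.2.
  have [W _ [g gf g_W]] := M_dir _ (face_of_in f).
  by apply: (trace_corner_end g_W); rewrite -(face_of_eq gf) face_of_refl.
have [f0 _ | no_flag] := pickP (@predT (flag D)); last first.
  by exists xpredT => f; have := no_flag f.
have [W W_euler [g gf g_W]] := M_euler _ (face_of_in f0).
(* [cross] changes only the second summand; [along] and [corner] change only the first. *)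
exists (fun f => f.1.2 (+) (f \in face_of M g)) => f.
rewrite (directed_euler_face_cross f W_euler g_W) along_in_face corner_in_face.
by rewrite corner_end /= addbN !addNb.
Qed.

End Orientable.

(** * The embedding whose rotation alternates heads and tails, and its two faces *)

Section TwoFaceEmbedding.

Variables (D : digraph) (t s : {perm darc D}).
Hypothesis src_t : forall a, src (t a) = tgt a.
Hypothesis t_trans : forall a b, fconnect t a b.
Hypothesis s_conn : forall a b, fconnect s a b = (tgt a == tgt b).
Hypothesis ts_trans : forall a b, fconnect (t \o s) a b.

Let tgt_s a : tgt (s a) = tgt a.
Proof. by apply/esym/eqP; rewrite -s_conn fconnect1. Qed.

Definition alternating_step (h : arc_end D) : arc_end D :=
  if h.2 then (t (s h.1), false) else ((t^-1)%g h.1, true).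

Lemma alternating_step_inj : injective alternating_step.
Proof.
case=> [a [|]] [b [|]] //= []; first by move/perm_inj/perm_inj->.
by move/perm_inj->.
Qed.

Definition alternating_rotation := perm alternating_step_inj.

Let rotE : alternating_rotation =1 alternating_step.
Proof. exact: permE. Qed.

Lemma alternating_rotation_vertex h h' :
  (h' \in porbit alternating_rotation h) = (end_vertex h' == end_vertex h).
Proof.
have -> : (h' \in porbit alternating_rotation h)
    = fconnect alternating_rotation h h'.
  apply/porbitP/idP => [[i ->]|/iter_findex<-].
    by rewrite permX fconnect_iter.
  by exists (findex alternating_rotation h h'); rewrite permX.
have rot_conn := fconnect_sym (@perm_inj _ alternating_rotation).
apply/idP/eqP => [hh'|eq_end].
  apply/esym/(fconnect_invariant _ hh') => -[a i] /=; apply/eqP.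
  rewrite rotE /end_vertex; case: i => /=; first by rewrite src_t tgt_s.
  by rewrite -[a in RHS](permKV t) src_t.
(* It suffices to join heads at the same vertex; two rotation steps lead from the head of [c] to the
   head of [s c], so [s_conn] joins them. *)
have to_head h1 : exists2 a, fconnect alternating_rotation h1 (a, true) &
    tgt a = end_vertex h1.
  case: h1 => a [|]; first by exists a; rewrite ?connect0.
  exists ((t^-1)%g a); last by rewrite -(src_t (_ a)) permKV.
  by rewrite -[(_, true)]/(alternating_step (a, false)) -rotE fconnect1.
have [a ha def_a] := to_head h; have [b hb def_b] := to_head h'.
apply: connect_trans ha _; rewrite rot_conn; apply: connect_trans hb _.
have : fconnect s b a by rewrite s_conn def_a def_b eq_end.
move/iter_findex<-; elim: findex => //= n; move: (iter n s b) => c.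
move/connect_trans; apply.
have <- : alternating_rotation (alternating_rotation (c, true)) = (s c, true).
  by rewrite !rotE /alternating_step /= permK.
exact: (fconnect_iter _ 2).
Qed.

Definition two_face_embedding : embedding D :=
  Embedding (fun=> false) alternating_rotation_vertex.

Local Notation M := two_face_embedding.

(** The arc permutation followed by face tracing from tails on side [o]; the product [s * t] is
    [t \o s]. *)
Definition side_step (o : bool) : {perm darc D} := if o then t else (s * t)%g.

Lemma side_step_trans o a b : fconnect (side_step o) a b.
Proof.
case: o => //=; rewrite (eq_fconnect (f' := t \o s)) // => c.
by rewrite /= permM.
Qed.

Lemma src_side_step o a : src (side_step o a) = tgt a.
Proof. by case: o; rewrite /= ?permM src_t. Qed.

Lemma face_step_side o a :
  face_step M ((a, false), o) = ((side_step o a, false), o).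
Proof.
case: o; rewrite /face_step /corner /along /other_end /=; last first.
  by rewrite rotE /alternating_step /= permM.
congr (_, true); apply: (@perm_inj _ alternating_rotation).
by rewrite permKV rotE /alternating_step /= permK.
Qed.

(** No arc is twisted and the rotation alternates, so [along] and [corner] each flip both bits and
    keep their sum. Conversely, [along] brings any flag to a tail, and the tails on one side form
    one cycle of [side_step]. *)
Lemma mem_two_face f g : (g \in face_of M f) = (g.1.2 (+) g.2 == f.1.2 (+) f.2).
Proof.
have alongE h : (along M h).1.2 (+) (along M h).2 = h.1.2 (+) h.2.
  by case: h => [[a []] []].
have cornerE h : (corner M h).1.2 (+) (corner M h).2 = h.1.2 (+) h.2.
  rewrite /corner; case: h => [[a i] []] /=.
    by rewrite rotE /alternating_step; case: i.
  rewrite -[i in RHS]/((a, i).2).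
  rewrite -[(a, i) in RHS](permKV alternating_rotation) rotE.
  by rewrite /alternating_step; case: (_.2).
apply/idP/eqP => [|eq_side].
  rewrite inE; pose P := [pred h : flag D | h.1.2 (+) h.2 == g.1.2 (+) g.2].
  have clP : closed [rel x y | (y == along M x) || (y == corner M x)] P.
    by move=> x y /= /orP[] /eqP->; rewrite !inE ?alongE ?cornerE.
  by move/(closed_connect clP); rewrite !inE eqxx => /eqP.
have to_tail h : exists a, face_of M h = face_of M ((a, false), h.1.2 (+) h.2).
  case: h => [[a i] o]; exists a; apply: face_of_eq.
  case: i; last exact: face_of_refl.
  rewrite -along_in_face.
  suff -> : along M ((a, false), true (+) o) = ((a, true), o).
    exact: face_of_refl.
  by rewrite /along /other_end /=; case: o.
have [a ->] := to_tail f; have [b gb] := to_tail g.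
have : face_of M (a, false, f.1.2 (+) f.2) = face_of M g.
  rewrite gb eq_side; apply: face_of_eq; set o := _ (+) _.
  have := side_step_trans o a b; move/iter_findex<-.
  elim: findex => [|n IHn] /=; first exact: face_of_refl.
  by rewrite -face_step_side /face_step corner_in_face along_in_face.
by move->; apply: face_of_refl.
Qed.

Definition side_face o : {set flag D} := [set f | f.1.2 (+) f.2 == o].

Lemma face_of_two f : face_of M f = side_face (f.1.2 (+) f.2).
Proof. by apply/setP=> g; rewrite mem_two_face inE. Qed.

(** Tracing from the tail of the first arc of [W] gives [W] itself, not merely a cyclic shift of
    it. *)
Lemma side_face_bounded o W : W <> [::] -> uniq W -> fcycle (side_step o) W ->
  bounded_by M (side_face o) W.
Proof.
case: W => // a W _ uW cW; exists ((a, false), o); first by rewrite inE.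
pose j (b : darc D) : flag D := ((b, false), o).
have j_inj : injective j by move=> b c [].
have /undup_cycle_cons <- : fcycle (face_step M) (j a :: map j W).
  rewrite -map_cons cycle_map; apply: sub_cycle cW => b c /= /eqP<-.
  by rewrite face_step_side.
by rewrite -map_cons undup_id ?map_inj_uniq // -map_comp.
Qed.

Lemma side_orbit_euler o a : (forall v : dvertex D, exists b, tgt b = v) ->
  directed_euler_circuit (orbit (side_step o) a).
Proof.
move=> v_head; have mem_orb b : b \in orbit (side_step o) a.
  by rewrite -fconnect_orbit side_step_trans.
split=> // [|v]; last first.
  by have [b <-] := v_head v; exists b; rewrite ?eqxx ?orbT.
split; last exact: orbit_uniq.
split; first by case: orbit (mem_orb a).
apply: sub_cycle (cycle_orbit (@perm_inj _ (side_step o)) a) => b c /= /eqP<-.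
by rewrite src_side_step.
Qed.

(** The arc [a] supplies a flag on each side, so both sides occur as faces. *)
Lemma two_face_bi_eulerian (a : darc D) :
  (forall v : dvertex D, exists b, tgt b = v) -> bi_eulerian M.
Proof.
move=> v_head; split=> [|_ /imsetP[f _ ->]].
  have -> : faces M = [set side_face false; side_face true].
    apply/setP=> F; rewrite !inE; apply/imsetP/orP => [[f _ ->]|].
      by rewrite face_of_two; case: (_ (+) _); rewrite eqxx; [right | left].
    by case=> /eqP->; [exists ((a, false), false) | exists ((a, false), true)];
       rewrite // face_of_two.
  rewrite cards2; case: eqVneq => // /setP/(_ ((a, false), false)).
  by rewrite !inE.
rewrite face_of_two; set o := _ (+) _.
have W_euler := side_orbit_euler o a v_head.
exists (orbit (side_step o) a) => //.
case: W_euler => [[[W_ne _] uW] _ _]; apply: side_face_bounded => //.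
by apply: cycle_orbit; apply: perm_inj.
Qed.

End TwoFaceEmbedding.

(** * From the given euler circuit to the embedding *)

Lemma bi_eulerian_directed (D : digraph) (M : embedding D) :
  bi_eulerian M -> directed_embedding M.
Proof.
by case=> _ euler F /euler[W [[W_walk _] _ _] F_W]; exists W.
Qed.

Theorem theorem4p5 (D : digraph) (D_eulerian : eulerian D)
    (D_degree : forall v : dvertex D, degree v = 2 %[mod 4])
    (T : seq (darc D)) (T_euler : directed_euler_circuit T) :
  (exists M : embedding D,
     [/\ directed_embedding M, bi_eulerian M
       & exists2 F, F \in faces M & bounded_by M F T]) /\
  (forall M : embedding D,
     directed_embedding M -> bi_eulerian M -> orientable M).
Proof.
split; last by move=> M; apply: directed_bi_eulerian_orientable.
have [[[T_ne T_walk] uT] T_all T_vertex] := T_euler.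
pose t := perm (can_inj (prev_next uT)).
have tE : t =1 next T by exact: permE.
have T_cycle : fcycle t T by rewrite (eq_fcycle tE) cycle_next.
have src_t a : src (t a) = tgt a.
  by apply/esym/eqP; rewrite tE; apply: next_cycle T_walk (T_all a).
have t_trans a b : fconnect t a b by rewrite (fconnect_cycle T_cycle).
have v_head v : exists b : darc D, tgt b = v.
  have [b _ /orP[] /eqP <-] := T_vertex v; last by exists b.
  by exists ((t^-1)%g b); rewrite -src_t permKV.
(* [t] maps the arcs into [v] bijectively onto the arcs out of [v], so the degree is twice the
   indegree, and the congruence modulo 4 halves to one modulo 2. *)
have in_odd v : odd #|[set a : darc D | tgt a == v]|.
  have := D_degree v; rewrite /degree.
  have -> : [set a : darc D | src a == v] = t @: [set a | tgt a == v].
    apply/setP=> a; rewrite inE -[a in LHS](permKV t) src_t.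
    by rewrite -[a in RHS](permKV t) mem_imset ?inE //; apply: perm_inj.
  rewrite card_imset; last exact: perm_inj.
  rewrite addnn -muln2 -[4]/(2 * 2) -[2 in RHS]/(1 * 2) -!muln_modl.
  by move/eqP; rewrite eqn_pmul2r // !modn2; case: odd.
have [s [s_conn ts_trans]] := odd_fiber_splice t_trans in_odd.
pose M := two_face_embedding src_t s_conn.
have [a aT] : exists a, a \in T.
  by case: (T) T_ne => // a W _; exists a; apply: mem_head.
have M_euler : bi_eulerian M by apply: two_face_bi_eulerian.
exists M; split=> //; first exact: bi_eulerian_directed.
(* Side [true] is the one traced by [t], hence by [T]. *)
exists (side_face D true); last exact: side_face_bounded.
rewrite -(face_of_two src_t t_trans s_conn ts_trans ((a, false), true)).
exact: face_of_in.
Qed.
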